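(* Let $\mathcal{H}$ be a complex Hilbert space, let $T\in\mathcal{L}(\mathcal{H})$ be a closed range operator and let $T=U_T-V$ be the polar proper splitting of $T$. Then the following assertions are equivalent: (1) the polar proper splitting of $T$ converges; (2) $\|U_T-T\|<1$; (3) $\|P_{T^*}-|T|\|<1$; (4) $\|T\|<2$.
   Context: $\mathcal{L}(\mathcal{H})$ is the algebra of bounded linear operators on $\mathcal{H}$ with the operator norm. $|T|=(T^*T)^{1/2}$, and $P_{T^*}$ is the orthogonal projection onto $\mathcal{R}(T^* )$. $T=U_T|T|$ is the polar decomposition, where $U_T$ is the partial isometry with $\mathcal{N}(U_T)=\mathcal{N}(T)$. A proper splitting of a closed range operator $T$ is a decomposition $T=U-V$ with $\mathcal{R}(U)=\mathcal{R}(T)$ and $\mathcal{N}(U)=\mathcal{N}(T)$; it converges if the spectral radius satisfies $\rho(U^\dagger V)<1$, where $U^\dagger$ is the Moore-Penrose inverse. The polar proper splitting of $T$ is $T=U_T-V$, i.e. $V=U_T-T$ (note $U_T^\dagger=U_T^*$). *)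

(* Defs.v *)
From HB Require Import structures.
From mathcomp Require Import all_boot all_order all_algebra sesquilinear.
From mathcomp Require Import complex.
From mathcomp Require Import all_classical all_reals all_analysis.

Set Implicit Arguments.
Unset Strict Implicit.
Unset Printing Implicit Defensive.

Import Order.TTheory GRing.Theory Num.Theory.
Import numFieldNormedType.Exports.

Local Open Scope classical_set_scope.
Local Open Scope ring_scope.
Local Open Scope complex_scope.

(* The inner product is linear in its first argument and conjugate-linear in
   its second one. *)
HB.mixin Record CompleteNormedModule_isHilbert (R : realType) H
    of CompleteNormedModule R[i] H := {
  inner : {dot H for Num.conj} ;
  inner_norm : forall x : H, `|x| ^+ 2 = inner x x
}.

#[short(type="hilbertType")]
HB.structure Definition Hilbert (R : realType) :=
  {H of CompleteNormedModule_isHilbert R H & CompleteNormedModule R[i] H}.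

Section Operators.
Variables (R : realType) (H : hilbertType R).
Implicit Types (A B T U V : H -> H) (M : set H).

(* Membership in L(H). *)
Definition bounded_operator A : Prop :=
  linear A /\ exists M : R, forall x : H, `|A x| <= M%:C * `|x|.

(* Norms of vectors and moduli of scalars live in R[i]; complex.Re brings them
   back to R, where suprema exist. *)
Definition opnorm A : R :=
  sup [set complex.Re `|A x| | x in [set x : H | `|x| <= 1]].

Definition op_kernel A : set H := [set x | A x = 0].

Definition orthogonal_to M : set H :=
  [set x | forall y, M y -> inner x y = 0].

(* get picks an element of a set. The operators defined with it below are the
   only elements of the sets they are picked from when A and T are bounded, M is
   a closed subspace and, moreover, A is positive for sqrt_operator and has
   closed range for moore_penrose. *)

Definition adjoint A : H -> H :=
  get [set B | forall x y, inner (A x) y = inner x (B y)].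

Definition positive_operator A : Prop :=
  bounded_operator A /\ forall x, 0 <= inner (A x) x.

Definition sqrt_operator A : H -> H :=
  get [set B | positive_operator B /\ B \o B = A].

Definition abs_operator T : H -> H := sqrt_operator (adjoint T \o T).

Definition orthoproj M : H -> H :=
  get [set P | forall x, M (P x) /\ orthogonal_to M (x - P x)].

Definition partial_isometry U : Prop :=
  bounded_operator U /\
  forall x, orthogonal_to (op_kernel U) x -> `|U x| = `|x|.

Definition polar_factor T : H -> H :=
  get [set U | [/\ partial_isometry U, T = U \o abs_operator T
                 & op_kernel U = op_kernel T]].

(* The bounded solution of the four Penrose equations. *)
Definition moore_penrose A : H -> H :=
  get [set B | bounded_operator B /\
    [/\ A \o B \o A = A, B \o A \o B = B,
        adjoint (A \o B) = A \o B & adjoint (B \o A) = B \o A]].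

Definition spectrum A : set R[i] :=
  [set z | ~ exists B, [/\ bounded_operator B,
     forall x, B (z *: x - A x) = x & forall x, z *: B x - A (B x) = x]].

(* For bounded A the spectrum is empty only if H = 0, and then sup set0 = 0. *)
Definition spectral_radius A : R := sup [set complex.Re `|z| | z in spectrum A].

Definition closed_range T : Prop := bounded_operator T /\ closed (range T).

Definition proper_splitting T U V : Prop :=
  [/\ bounded_operator U, bounded_operator V, T = U \- V,
      range U = range T & op_kernel U = op_kernel T].

Definition convergent_proper_splitting T U V : Prop :=
  proper_splitting T U V /\ spectral_radius (moore_penrose U \o V) < 1.

End Operators.

(* Main.v *)
(* The norm [|U_T x - T x|] equals [|P x - |T| x|], where [P] projects onto
   [N(T)^perp = R(T^* )], because [U_T] is isometric there; likewise
   [U_T^+ V = P - |T|]. On [N(T)^perp] the positive operator [S = |T|] is bounded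
   below, and [|S x|^2 <= |S| <S x, x>], so that
   [|x - S x|^2 <= |x|^2 - (2 - |S|) <S x, x>], which gives [|P - S| < 1] as soon
   as [|S| = |T| < 2]. Conversely [|S|] is an approximate eigenvalue of [S], hence
   [1 - |S|] is in the spectrum of [P - S], and spectral radius [< 1] forces
   [|S| < 2].
   The bound from below comes from the uniform boundedness principle applied to
   the vectors [v] of [R(T)] with [|T^* v| <= 1]. It also makes [T^* T] a multiple
   of [P - C] with [|C| < 1], so that its square root is the limit of a
   geometrically convergent iteration. *)

Require Import Defs.
From mathcomp Require Import all_boot all_order all_algebra sesquilinear complex.
From mathcomp Require Import all_classical all_reals all_analysis.
From mathcomp Require Import ring lra.

Set Implicit Arguments.
Unset Strict Implicit.
Unset Printing Implicit Defensive.

Import Order.TTheory GRing.Theory Num.Theory.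
Import numFieldNormedType.Exports.

Local Open Scope classical_set_scope.
Local Open Scope ring_scope.
Local Open Scope complex_scope.

(** * Norms and inner products *)

Section Inner.
Variables (R : realType) (H : hilbertType R).
Implicit Types (x y z : H) (a : R[i]) (k : R).

(** Real-valued norm and inner product: over [R[i]] both take complex values, while square roots,
    suprema and [lra] work in [R]. *)
Definition nrm x : R := complex.Re `|x|.
Definition rdot x y : R := complex.Re (inner x y).

Lemma ReD (a b : R[i]) : complex.Re (a + b) = complex.Re a + complex.Re b.
Proof. by case: a; case: b. Qed.

Lemma ReN (a : R[i]) : complex.Re (- a) = - complex.Re a.
Proof. by case: a. Qed.

Lemma Re_mulC k a : complex.Re (k%:C * a) = k * complex.Re a.
Proof. by case: a => u v /=; rewrite mul0r subr0. Qed.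

Lemma nrmE x : `|x| = (nrm x)%:C.
Proof. by rewrite /nrm RRe_real// ger0_real. Qed.

Lemma normcRe a : `|a| = (complex.Re `|a|)%:C.
Proof. by rewrite RRe_real// ger0_real. Qed.

Lemma nrm_ge0 x : 0 <= nrm x.
Proof. by rewrite -ler0c -nrmE. Qed.

Lemma nrm_eq0 x : (nrm x == 0) = (x == 0).
Proof. by rewrite -(inj_eq (@complexI R)) -nrmE normr_eq0. Qed.

Lemma nrm0 : nrm 0 = 0.
Proof. by apply/eqP; rewrite nrm_eq0. Qed.

Lemma nrm_le_eq0 x : nrm x <= 0 -> x = 0.
Proof. by move=> x0; apply/eqP; rewrite -nrm_eq0 eq_le x0 nrm_ge0. Qed.

Lemma nrmD x y : nrm (x + y) <= nrm x + nrm y.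
Proof. by rewrite -lecR rmorphD/= -!nrmE ler_normD. Qed.

Lemma nrmN x : nrm (- x) = nrm x.
Proof. by rewrite /nrm normrN. Qed.

Lemma nrmBC x y : nrm (x - y) = nrm (y - x).
Proof. by rewrite -nrmN opprB. Qed.

Lemma nrm_dist z x y : nrm (x - y) <= nrm (x - z) + nrm (z - y).
Proof. by have := nrmD (x - z) (z - y); rewrite addrA subrK. Qed.

Lemma nrmZ a x : nrm (a *: x) = complex.Re `|a| * nrm x.
Proof.
by apply: (@complexI R); rewrite -nrmE normrZ rmorphM/= -normcRe -nrmE.
Qed.

Lemma nrmZr k x : nrm (k%:C *: x) = `|k| * nrm x.
Proof. by rewrite nrmZ normc_def/= expr0n/= addr0 sqrtr_sqr. Qed.

Lemma innerDl x y z : inner (x + y) z = inner x z + inner y z.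
Proof. exact: linearDl. Qed.
Lemma innerDr x y z : inner z (x + y) = inner z x + inner z y.
Proof. exact: linearDr. Qed.
Lemma innerNl x y : inner (- x) y = - inner x y.
Proof. exact: linearNl. Qed.
Lemma innerNr x y : inner x (- y) = - inner x y.
Proof. exact: linearNr. Qed.
Lemma innerBl x y z : inner (x - y) z = inner x z - inner y z.
Proof. by rewrite innerDl innerNl. Qed.
Lemma innerBr x y z : inner z (x - y) = inner z x - inner z y.
Proof. by rewrite innerDr innerNr. Qed.
Lemma innerZl a x y : inner (a *: x) y = a * inner x y.
Proof. exact: linearZl_LR. Qed.
Lemma innerZr a x y : inner x (a *: y) = conjc a * inner x y.
Proof. exact: linearZr_LR. Qed.
Lemma innerC x y : inner y x = conjc (inner x y).
Proof. by rewrite hermC expr0 mul1r. Qed.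
Lemma inner0l x : inner 0 x = 0.
Proof. by rewrite -(scale0r 0) innerZl mul0r. Qed.
Lemma inner0r x : inner x 0 = 0.
Proof. by rewrite innerC inner0l conjc0. Qed.

Lemma inner_eq0C x y : inner x y = 0 -> inner y x = 0.
Proof. by move=> xy0; rewrite innerC xy0 conjc0. Qed.

Lemma innerxx x : inner x x = (nrm x ^+ 2)%:C.
Proof. by rewrite -inner_norm nrmE rmorphXn. Qed.

Lemma inner_eq0 x : inner x x = 0 -> x = 0.
Proof.
rewrite innerxx => /(@complexI R _ 0)/eqP.
by rewrite sqrf_eq0 nrm_eq0 => /eqP.
Qed.

Lemma inner_inj x y : (forall z, inner z x = inner z y) -> x = y.
Proof.
move=> xy; apply/subr0_eq/inner_eq0.
by rewrite innerBr xy subrr.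
Qed.

Lemma inner_injl x y : (forall z, inner x z = inner y z) -> x = y.
Proof.
move=> xy; apply/subr0_eq/inner_eq0.
by rewrite innerBl xy subrr.
Qed.

Lemma rdotxx x : rdot x x = nrm x ^+ 2.
Proof. by rewrite /rdot innerxx. Qed.

Lemma rdotC x y : rdot x y = rdot y x.
Proof. by rewrite /rdot innerC; case: (inner y x). Qed.
Lemma rdotDl x y z : rdot (x + y) z = rdot x z + rdot y z.
Proof. by rewrite /rdot innerDl ReD. Qed.
Lemma rdotDr x y z : rdot z (x + y) = rdot z x + rdot z y.
Proof. by rewrite rdotC rdotDl !(rdotC z). Qed.
Lemma rdotNl x y : rdot (- x) y = - rdot x y.
Proof. by rewrite /rdot innerNl ReN. Qed.
Lemma rdotNr x y : rdot y (- x) = - rdot y x.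
Proof. by rewrite rdotC rdotNl rdotC. Qed.
Lemma rdotZl k x y : rdot (k%:C *: x) y = k * rdot x y.
Proof. by rewrite /rdot innerZl Re_mulC. Qed.
Lemma rdotZr k x y : rdot x (k%:C *: y) = k * rdot x y.
Proof. by rewrite rdotC rdotZl rdotC. Qed.

(** Recovers the imaginary part of [inner] from [rdot], so that facts proved for real parts extend
    to the complex product. *)
Lemma rdotZi x y : rdot x ('i *: y) = complex.Im (inner x y).
Proof. by rewrite /rdot innerZr; case: (inner x y) => u v /=; ring. Qed.

Lemma nrmD_sq x y : nrm (x + y) ^+ 2 = nrm x ^+ 2 + 2 * rdot x y + nrm y ^+ 2.
Proof. by rewrite -!rdotxx !rdotDl !rdotDr (rdotC y x); ring. Qed.

Lemma nrmB_sq x y : nrm (x - y) ^+ 2 = nrm x ^+ 2 - 2 * rdot x y + nrm y ^+ 2.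
Proof. by rewrite nrmD_sq rdotNr nrmN; ring. Qed.

Lemma CauchySchwarz_inner x y : `|inner x y| <= (nrm x * nrm y)%:C.
Proof.
have [->|y0] := eqVneq y 0; first by rewrite inner0r normr0 nrm0 mulr0.
have n0 : 0 < nrm y by rewrite lt_def nrm_eq0 y0 nrm_ge0.
set d : R[i] := inner x y.
(* Nonnegativity of this square gives m (m n - |d|^2) >= 0; scaling [x] by m = |y|^2 avoids a
   division. *)
have : 0 <= inner ((nrm y ^+ 2)%:C *: x - d *: y) ((nrm y ^+ 2)%:C *: x - d *: y).
  by rewrite innerxx ler0c sqr_ge0.
rewrite innerBl !innerBr !innerZl !innerZr conjc_real (innerC x y) -/d.
rewrite !innerxx.
set m := (nrm y ^+ 2)%:C; set n := (nrm x ^+ 2)%:C.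
have -> : m * (m * n) - m * (conjc d * d) -
    (d * (m * conjc d) - d * (conjc d * m)) = m * (m * n - d * conjc d) by ring.
rewrite pmulr_rge0; last by rewrite ltcR exprn_gt0.
rewrite -sqr_normc subr_ge0 normcRe /m /n -rmorphM -rmorphXn !lecR/= => dmn.
by rewrite -ler_sqr ?nnegrE ?mulr_ge0 ?nrm_ge0 -?ler0c -?normcRe// exprMn mulrC.
Qed.

Lemma rdot_le x y : `|rdot x y| <= nrm x * nrm y.
Proof.
rewrite -lecR; apply: le_trans (CauchySchwarz_inner x y).
exact: normc_ge_Re.
Qed.

Lemma parallelogram x y :
  nrm (x + y) ^+ 2 + nrm (x - y) ^+ 2 = 2 * nrm x ^+ 2 + 2 * nrm y ^+ 2.
Proof. by rewrite nrmD_sq nrmB_sq; ring. Qed.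

Lemma ler_nrm x k : 0 <= k -> nrm x ^+ 2 <= k ^+ 2 -> nrm x <= k.
Proof. by move=> k0; rewrite ler_sqr// nnegrE nrm_ge0. Qed.

(** Completeness of the space enters here. The explicit rate lets later limits be handled by
    estimates in [n], by way of [ler_geometric]. *)
Lemma geometric_cauchy (u : nat -> H) (C q : R) : 0 <= q < 1 ->
  (forall n, nrm (u n.+1 - u n) <= C * q ^+ n) ->
  exists l, forall n, nrm (l - u n) <= C / (1 - q) * q ^+ n.
Proof.
move=> /andP[q0 q1] uC.
have q1' : 0 < 1 - q by rewrite subr_gt0.
have C0 : 0 <= C.
  by have := uC 0%N; rewrite expr0 mulr1; apply: le_trans (nrm_ge0 _).
pose D := C / (1 - q).
have DE : C = D * (1 - q) by rewrite /D divfK// gt_eqF.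
have D0 : 0 <= D by rewrite divr_ge0// ltW.
have Dq0 n : 0 <= D * q ^+ n by apply: mulr_ge0 => //; exact: exprn_ge0.
(* Since C = D (1 - q), each increment C q^n is the difference D q^n - D q^(n+1), and the sum
   telescopes. *)
have step n m : nrm (u (n + m)%N - u n) <= D * q ^+ n - D * q ^+ (n + m).
  elim: m => [|m IHm]; first by rewrite addn0 !subrr nrm0.
  apply: le_trans (nrm_dist (u (n + m)%N) _ _) _.
  rewrite addnS; apply: le_trans (lerD (uC _) IHm) _.
  by rewrite DE exprS le_eqVlt; apply/orP; left; apply/eqP; ring.
have dist n m : (n <= m)%N -> nrm (u m - u n) <= D * q ^+ n.
  move=> nm; have := step n (m - n)%N; rewrite subnKC// => /le_trans; apply.
  by rewrite lerBlDr lerDl.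
have small e : 0 < e -> exists N, D * q ^+ N <= e.
  move=> e0.
  have qn : (fun n => D * q ^+ n) @ \oo --> (0 : R).
    by apply: (@cvg_geometric R D q); rewrite ger0_norm.
  move/cvgrPdist_le : qn => /(_ _ e0)[N _ /(_ N)/=]; rewrite leqnn => /(_ isT).
  by rewrite sub0r normrN ger0_norm// => qe; exists N.
have uc : cvg (u @ \oo).
  apply: cauchy_cvg; apply: cauchy_exP => e e0.
  have e0' : 0 < complex.Re e by move: e0; rewrite ltcE => /andP[_].
  have [N Ne] := small _ (divr_gt0 e0' (ltr0n _ 2)).
  exists (u N), N => // n /= Nn; rewrite -ball_normE /ball_/=.
  rewrite nrmE ltcE/= ger0_Im ?ltW// eqxx/=.
  rewrite nrmBC; apply: le_lt_trans (dist _ _ Nn) _; apply: le_lt_trans Ne _.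
  by rewrite ltr_pdivrMr// ltr_pMr// ltr1n.
exists (lim (u @ \oo)) => n.
rewrite -/D; apply/ler_addgt0Pr => e e0.
move/cvgrPdist_le : uc => /(_ e%:C).
rewrite ltcR => /(_ e0)[N _ /(_ (maxn N n))/=].
rewrite leq_maxl nrmE lecR => /(_ isT) le1.
apply: le_trans (nrm_dist (u (maxn N n)) _ _) _; rewrite addrC.
by apply: lerD => //; apply: dist; exact: leq_maxr.
Qed.

Lemma closed_nrm (M : set H) x : closed M ->
  (forall e, 0 < e -> exists2 m, M m & nrm (x - m) < e) -> M x.
Proof.
move=> clM xM; apply: clM => B /nbhs_ballP[e/= e0 eB].
have e0' : 0 < complex.Re e by move: e0; rewrite ltcE => /andP[_].
have [m Mm xm] := xM _ e0'; exists m; split => //; apply: eB.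
by rewrite -ball_normE /ball_/= nrmE ltcE/= ger0_Im ?ltW// eqxx.
Qed.

End Inner.

(** * Orthogonal projections *)

Section Operators.
Variables (R : realType) (H : hilbertType R).
Implicit Types (x y z : H) (a : R[i]) (k : R) (M : set H) (A B : H -> H).

Lemma ler_geometric (a b C q : R) : 0 <= q < 1 ->
  (forall n, a <= b + C * q ^+ n) -> a <= b.
Proof.
move=> /andP[q0 q1] ab; apply/ler_addgt0Pr => e e0.
have qn : (fun n => C * q ^+ n) @ \oo --> (0 : R).
  by apply: (@cvg_geometric R C q); rewrite ger0_norm.
move/cvgrPdist_le : qn => /(_ _ e0)[N _ /(_ N)/=]; rewrite leqnn => /(_ isT).
rewrite sub0r normrN => /ler_normlW qe.
by apply: le_trans (ab N) _; rewrite lerD2l.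
Qed.

Lemma closed_nrmP M :
  (forall x, (forall e, 0 < e -> exists2 m, M m & nrm (x - m) < e) -> M x) ->
  closed M.
Proof.
move=> clM x clx; apply: clM => e e0.
have e0' : 0 < e%:C by rewrite ltcR.
have [m [Mm]] := clx (ball x e%:C) (nbhsx_ballx _ _ e0').
by rewrite -ball_normE /ball_/= nrmE ltcR => xm; exists m.
Qed.

Definition lin_subspace M :=
  M 0 /\ forall a x y, M x -> M y -> M (a *: x + y).

Section Subspace.
Variable M : set H.
Hypothesis subM : lin_subspace M.

Lemma lin_subspaceZ a x : M x -> M (a *: x).
Proof. by case: subM => M0 MD Mx; rewrite -[_ *: _]addr0; apply: MD. Qed.

Lemma lin_subspaceD x y : M x -> M y -> M (x + y).
Proof. by case: subM => M0 MD Mx My; rewrite -[x]scale1r; apply: MD. Qed.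

Lemma lin_subspaceB x y : M x -> M y -> M (x - y).
Proof.
move=> Mx My; apply: lin_subspaceD => //.
by rewrite -scaleN1r; apply: lin_subspaceZ.
Qed.

(** [M] is stable under multiplication by ['i], which supplies the imaginary part. *)
Lemma orthogonal_rdot z : (forall m, M m -> rdot z m = 0) -> orthogonal_to M z.
Proof.
move=> zM m Mm.
have := zM _ Mm; have := zM _ (lin_subspaceZ 'i Mm); rewrite rdotZi /rdot.
by case: (inner z m) => u v /= -> ->.
Qed.

Lemma orthogonal_minimizer z :
  (forall m, M m -> nrm z <= nrm (z - m)) -> orthogonal_to M z.
Proof.
move=> zmin; apply: orthogonal_rdot => m Mm.
have [->|m0] := eqVneq m 0; first by rewrite /rdot inner0r.
have n0 : 0 < nrm m ^+ 2 by rewrite exprn_gt0// lt_def nrm_eq0 m0 nrm_ge0.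
set r := rdot z m.
(* The subtracted vector is the projection of [z] on the real line spanned by [m]; it lowers the
   squared norm by r^2 / |m|^2. *)
have := zmin _ (lin_subspaceZ (r / nrm m ^+ 2)%:C Mm).
rewrite -ler_sqr ?nnegrE ?nrm_ge0// nrmB_sq rdotZr -/r nrmZr exprMn.
rewrite real_normK ?num_real// expr_div_n.
rewrite -addrA lerDl => le0.
have : 0 <= - (r ^+ 2 / nrm m ^+ 2).
  apply: le_trans le0 _; rewrite le_eqVlt; apply/orP; left; apply/eqP.
  by field; rewrite nrm_eq0.
rewrite oppr_ge0 pmulr_lle0 ?invr_gt0// => r0.
by apply/eqP; rewrite -sqrf_eq0 eq_le r0 sqr_ge0.
Qed.

Lemma projection_exists x : closed M -> exists p, M p /\ orthogonal_to M (x - p).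
Proof.
move=> clM.
pose E := [set nrm (x - m) ^+ 2 | m in M].
have infE : has_inf E.
  split; first by exists (nrm (x - 0) ^+ 2); exists 0 => //; case: subM.
  by exists 0 => _ [m _ <-]; exact: sqr_ge0.
have half01 : 0 <= (2^-1 : R) < 1.
  by rewrite invr_ge0 ler0n invf_lt1// ltr1n.
have h0 n : 0 < (2^-1 : R) ^+ n by rewrite exprn_gt0// invr_gt0.
have dle m : M m -> inf E <= nrm (x - m) ^+ 2.
  by move=> Mm; apply: ge_inf; [case: infE|exists m].
(* A squared error of 4^-n makes the successive differences of order 2^-n. *)
have /choice[u uP] n : exists m,
    M m /\ nrm (x - m) ^+ 2 <= inf E + (2^-1 ^+ n) ^+ 2.
  have [_ [m Mm <-] mlt] := inf_adherent (exprn_gt0 2 (h0 n)) infE.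
  by exists m; split => //; exact: ltW.
have Mu n := (uP n).1.
have du n := (uP n).2.
have uC n : nrm (u n.+1 - u n) <= 2 * 2^-1 ^+ n.
  apply: ler_nrm; first by rewrite mulr_ge0// ltW.
  (* The midpoint of [u n] and [u n.+1] lies in [M], so its squared distance to [x] is at least
     [inf E]; the parallelogram law then bounds |u_(n+1) - u_n|^2 by (5/2) 4^-n. *)
  have := parallelogram (x - u n) (x - u n.+1).
  have -> : x - u n - (x - u n.+1) = u n.+1 - u n.
    by rewrite opprB addrC addrA subrK.
  have -> : x - u n + (x - u n.+1) = 2%:C *: (x - 2^-1%:C *: (u n + u n.+1)).
    rewrite scalerBr scalerA -rmorphM/= divff ?pnatr_eq0//.
    rewrite (_ : 2%:C = 2%:R) ?rmorph_nat// scaler_nat mulr2n scale1r opprD.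
    by rewrite addrACA.
  rewrite nrmZr ger0_norm// exprMn.
  have := dle _ (lin_subspaceZ 2^-1%:C (lin_subspaceD (Mu n) (Mu n.+1))).
  have := du n; have := du n.+1; rewrite [2^-1 ^+ n.+1]exprS.
  move: (h0 n); set h := 2^-1 ^+ n => h0n.
  have := sqr_ge0 h; rewrite !exprMn.
  set n1 := nrm (x - u n.+1) ^+ 2; set n2 := nrm (x - u n) ^+ 2.
  set n3 := nrm (x - _ *: _) ^+ 2; set n4 := nrm (u n.+1 - u n) ^+ 2.
  have -> : 2^-1 ^+ 2 = 4^-1 :> R by field.
  have -> : 2 ^+ 2 = 4 :> R by ring.
  move: (inf E) (h ^+ 2) n1 n2 n3 n4 => *; lra.
have [p pu] := geometric_cauchy half01 uC.
have M_p : M p.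
  apply: closed_nrm clM _ => e e0.
  apply: contrapT => /forall2NP H0.
  suff : e <= 0 by rewrite leNgt e0.
  apply: (@ler_geometric _ _ (2 / (1 - 2^-1)) _ half01) => n; rewrite add0r.
  have [//|] := H0 (u n).
  by move/negP; rewrite -leNgt => /le_trans; apply; exact: pu.
exists p; split => //; apply: orthogonal_minimizer => m Mm.
(* |x - p| <= |x - u_n| + |u_n - p|, and |x - u_n| exceeds |x - (p + m)| by at most 2^-n. *)
apply: (@ler_geometric _ _ (1 + 2 / (1 - 2^-1)) _ half01) => n.
rewrite -addrA -opprD mulrDl mul1r addrA.
apply: le_trans (nrm_dist (u n) _ _) _.
rewrite (nrmBC (u n)); apply: lerD; last exact: pu.
apply: ler_nrm; first by rewrite addr_ge0 ?nrm_ge0// ltW.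
apply: le_trans (du n) _.
apply: le_trans (lerD (dle _ (lin_subspaceD M_p Mm)) (lexx _)) _.
by rewrite sqrrD -addrA lerD2l lerDr mulrn_wge0// mulr_ge0 ?nrm_ge0// ltW.
Qed.

End Subspace.

End Operators.

(** * Bounded operators and adjoints *)

Section BoundedOperators.
Variables (R : realType) (H : hilbertType R).
Implicit Types (x y z : H) (a : R[i]) (k : R) (M : set H) (A B : H -> H).

Section Linear.
Variable A : H -> H.
Hypothesis linA : linear A.

Lemma opD x y : A (x + y) = A x + A y.
Proof. by have := linA 1 x y; rewrite !scale1r. Qed.

Lemma op0 : A 0 = 0.
Proof. by apply: (addrI (A 0)); rewrite -opD !addr0. Qed.

Lemma opZ a x : A (a *: x) = a *: A x.
Proof. by have := linA a x 0; rewrite op0 !addr0. Qed.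

Lemma opN x : A (- x) = - A x.
Proof. by rewrite -scaleN1r opZ scaleN1r. Qed.

Lemma opB x y : A (x - y) = A x - A y.
Proof. by rewrite opD opN. Qed.

Lemma lin_subspace_kernel : lin_subspace (op_kernel A).
Proof.
split; first exact: op0.
by move=> a x y; rewrite /op_kernel/= linA => -> ->; rewrite scaler0 addr0.
Qed.

Lemma lin_subspace_image M : lin_subspace M -> lin_subspace (A @` M).
Proof.
move=> [M0 MD]; split; first by exists 0 => //; exact: op0.
by move=> a _ _ [x Mx <-] [y My <-]; exists (a *: x + y); [exact: MD|exact: linA].
Qed.

End Linear.

Lemma lin_subspace_range A : linear A -> lin_subspace (range A).
Proof. by move=> linA; apply: lin_subspace_image. Qed.

Lemma lin_subspace_ortho M : lin_subspace (orthogonal_to M).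
Proof.
split; first by move=> y _; exact: inner0l.
move=> a x y xM yM z Mz.
by rewrite innerDl innerZl xM// yM// mulr0 addr0.
Qed.

Lemma closed_ortho M : closed (orthogonal_to M).
Proof.
apply: closed_nrmP => x xM y My; apply/eqP; rewrite -normr_le0 normcRe.
have [->|y0] := eqVneq y 0; first by rewrite inner0r normr0.
have ny : 0 < nrm y by rewrite lt_def nrm_eq0 y0 nrm_ge0.
rewrite (lecR _ 0); apply/ler_addgt0Pr => e e0; rewrite add0r.
have [m mM xm] := xM _ (divr_gt0 e0 ny).
have -> : inner x y = inner (x - m) y by rewrite innerBl mM// subr0.
rewrite -lecR -normcRe; apply: le_trans (CauchySchwarz_inner _ _) _.
by rewrite lecR -ler_pdivlMr// ltW.
Qed.

Lemma ortho_disjoint M x : M x -> orthogonal_to M x -> x = 0.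
Proof. by move=> Mx /(_ _ Mx); exact: inner_eq0. Qed.

Lemma ortho_sub M x : M x -> orthogonal_to (orthogonal_to M) x.
Proof. by move=> Mx y yM; apply: inner_eq0C; exact: yM. Qed.

Lemma ortho_ortho M x : lin_subspace M -> closed M ->
  orthogonal_to (orthogonal_to M) x -> M x.
Proof.
move=> subM clM xM; have [p [Mp pM]] := projection_exists subM x clM.
suff /subr0_eq -> : x - p = 0 by [].
apply: (ortho_disjoint pM); apply: (lin_subspaceB (lin_subspace_ortho _)) => //.
exact: ortho_sub.
Qed.

Lemma bounded_operatorP A : bounded_operator A <->
  linear A /\ exists2 k, 0 <= k & forall x, nrm (A x) <= k * nrm x.
Proof.
split => -[linA].
  move=> [k Ak]; split => //; exists (Num.max k 0).
    by rewrite le_max lexx orbT.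
  move=> x; have := Ak x; rewrite !nrmE -rmorphM lecR => /le_trans; apply.
  by rewrite ler_wpM2r ?nrm_ge0// le_max lexx.
move=> [k _ Ak]; split => //; exists k => x.
by rewrite !nrmE -rmorphM lecR.
Qed.

Lemma opnorm_set A : opnorm A = sup [set nrm (A x) | x in [set x | nrm x <= 1]].
Proof.
rewrite /opnorm; congr sup; congr image.
by apply/funext => x /=; rewrite nrmE lecR.
Qed.

Lemma opnorm_le A k : 0 <= k -> (forall x, nrm (A x) <= k * nrm x) ->
  opnorm A <= k.
Proof.
move=> k0 Ak; rewrite opnorm_set; apply: ge_sup.
  by exists (nrm (A 0)); exists 0 => //=; rewrite nrm0.
move=> _ [x /= x1 <-]; apply: le_trans (Ak x) _.
by rewrite -[leRHS]mulr1 ler_wpM2l.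
Qed.

Lemma opnorm_ub A : bounded_operator A -> forall x, nrm (A x) <= opnorm A * nrm x.
Proof.
move=> /bounded_operatorP[linA [k k0 Ak]] x.
have [->|x0] := eqVneq x 0; first by rewrite op0// nrm0 mulr0.
have nx : 0 < nrm x by rewrite lt_def nrm_eq0 x0 nrm_ge0.
rewrite -ler_pdivrMr// opnorm_set; apply: ub_le_sup.
  exists k => _ [z /= z1 <-]; apply: le_trans (Ak z) _.
  by rewrite -[leRHS]mulr1 ler_wpM2l.
exists ((nrm x)^-1%:C *: x) => /=.
  by rewrite nrmZr ger0_norm ?invr_ge0 ?nrm_ge0// mulVf// gt_eqF.
by rewrite opZ// nrmZr ger0_norm ?invr_ge0 ?nrm_ge0// mulrC.
Qed.

Lemma opnorm_ge0 A : bounded_operator A -> 0 <= opnorm A.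
Proof.
move=> /bounded_operatorP[linA [k k0 Ak]].
rewrite opnorm_set; apply: le_trans (nrm_ge0 (A 0)) _.
apply: ub_le_sup; last by exists 0 => //=; rewrite nrm0.
exists k => _ [z /= z1 <-]; apply: le_trans (Ak z) _.
by rewrite -[leRHS]mulr1 ler_wpM2l.
Qed.

Lemma bounded_comp A B : bounded_operator A -> bounded_operator B ->
  bounded_operator (A \o B).
Proof.
move=> /bounded_operatorP[linA [k k0 Ak]] /bounded_operatorP[linB [l l0 Bl]].
apply/bounded_operatorP; split; first by move=> a x y /=; rewrite linB linA.
exists (k * l); first exact: mulr_ge0.
by move=> x /=; apply: le_trans (Ak _) _; rewrite -mulrA ler_wpM2l.
Qed.

Lemma bounded_sub A B : bounded_operator A -> bounded_operator B ->
  bounded_operator (A \- B).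
Proof.
move=> /bounded_operatorP[linA [k k0 Ak]] /bounded_operatorP[linB [l l0 Bl]].
apply/bounded_operatorP; split.
  by move=> a x y /=; rewrite linB linA scalerBr opprD addrACA.
exists (k + l); first exact: addr_ge0.
move=> x /=; apply: le_trans (nrmD _ _) _; rewrite nrmN mulrDl.
exact: lerD.
Qed.

Lemma closed_kernel A : bounded_operator A -> closed (op_kernel A).
Proof.
move=> bA; apply: closed_nrmP => x xA; apply: nrm_le_eq0.
have [linA [k k0 Ak]] := (bounded_operatorP A).1 bA.
apply/ler_addgt0Pr => e e0; rewrite add0r.
have k1 : 0 < k + 1 by rewrite ltr_wpDl.
have [m Am xm] := xA _ (divr_gt0 e0 k1).
have -> : A x = A (x - m) by rewrite opB// Am subr0.
apply: le_trans (Ak _) _.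
apply: (@le_trans _ _ ((k + 1) * nrm (x - m))).
  by rewrite ler_wpM2r ?nrm_ge0// lerDl.
by rewrite mulrC -ler_pdivlMr// ltW.
Qed.

(** A vector [z] orthogonal to the closed kernel [K] represents [f] up to a scalar, because
    [f y *: z - f z *: y] lies in [K]. *)
Lemma Riesz (f : H -> R[i]) k :
  (forall a x y, f (a *: x + y) = a * f x + f y) ->
  (forall x, `|f x| <= (k * nrm x)%:C) -> exists v, forall x, f x = inner x v.
Proof.
move=> linf fk.
have f0 : f 0 = 0.
  by apply: (addrI (f 0)); have := linf 1 0 0; rewrite scale1r mul1r !addr0.
have fZ a x : f (a *: x) = a * f x by rewrite -[_ *: _]addr0 linf f0 addr0.
have fB x y : f (x - y) = f x - f y.
  by rewrite addrC -scaleN1r linf mulN1r addrC.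
pose K := [set x | f x = 0].
have subK : lin_subspace K.
  by split => // a x y; rewrite /K/= linf => -> ->; rewrite mulr0 addr0.
have k0 : 0 <= Num.max k 0 by rewrite le_max lexx orbT.
have {}fk x : `|f x| <= (Num.max k 0 * nrm x)%:C.
  apply: le_trans (fk x) _.
  by rewrite lecR ler_wpM2r ?nrm_ge0// le_max lexx.
have clK : closed K.
  apply: closed_nrmP => x xK; apply/eqP; rewrite -normr_le0 normcRe (lecR _ 0).
  apply/ler_addgt0Pr => e e0; rewrite add0r.
  have k1 : 0 < Num.max k 0 + 1 by rewrite ltr_wpDl.
  have [m fm xm] := xK _ (divr_gt0 e0 k1).
  have -> : f x = f (x - m) by rewrite fB fm subr0.
  rewrite -lecR -normcRe; apply: le_trans (fk _) _; rewrite lecR.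
  apply: (@le_trans _ _ ((Num.max k 0 + 1) * nrm (x - m))).
    by rewrite ler_wpM2r ?nrm_ge0// lerDl.
  by rewrite mulrC -ler_pdivlMr// ltW.
have [fx0|/existsNP[x /eqP fx]] := pselect (forall x, f x = 0).
  by exists 0 => x; rewrite fx0 inner0r.
have [p [fp pK]] := projection_exists subK x clK.
pose z := x - p.
have fz : f z != 0 by rewrite fB fp subr0.
have zz : inner z z != 0.
  by apply: contra_neq fz => /inner_eq0 ->.
exists (conjc (f z / inner z z) *: z) => y.
rewrite innerZr conjcK.
have /pK/inner_eq0C : K (f y *: z - f z *: y).
  by rewrite /K/= fB !fZ mulrC subrr.
rewrite -/z innerBl !innerZl => /subr0_eq fyz.
by rewrite mulrAC -fyz mulfK.
Qed.

(** A relation, because [adjoint] is picked by [get] and is meaningful only once existence is known.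
    Self-adjointness reads [adjoint_pair A A]. *)
Definition adjoint_pair A B := forall x y, inner (A x) y = inner x (B y).

Lemma adjoint_exists A : bounded_operator A -> exists B, adjoint_pair A B.
Proof.
move=> /bounded_operatorP[linA [k k0 Ak]].
suff /choice[B AB] y : exists v, forall x, inner (A x) y = inner x v by exists B.
apply: (@Riesz _ (k * nrm y)) => [a x z|x]; first by rewrite linA innerDl innerZl.
apply: le_trans (CauchySchwarz_inner _ _) _.
by rewrite lecR mulrAC ler_wpM2r ?nrm_ge0.
Qed.

Lemma adjointP A : bounded_operator A -> adjoint_pair A (adjoint A).
Proof. by move=> /adjoint_exists; exact: getPex. Qed.

Lemma adjoint_pairC A B : adjoint_pair A B -> adjoint_pair B A.
Proof. by move=> AB x y; rewrite innerC -AB -innerC. Qed.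

Lemma adjoint_uniq A B : bounded_operator A -> adjoint_pair A B -> adjoint A = B.
Proof.
move=> bA AB; apply/funext => y; apply: inner_inj => x.
by rewrite -(adjointP bA) AB.
Qed.

Lemma bounded_adjoint_pair A B : bounded_operator A -> adjoint_pair A B ->
  bounded_operator B.
Proof.
move=> /bounded_operatorP[linA [k k0 Ak]] AB; apply/bounded_operatorP; split.
  move=> a x y; apply: inner_inj => z.
  by rewrite -AB !innerDr !innerZr !AB.
exists k => // y.
have [->|By0] := eqVneq (B y) 0; first by rewrite nrm0 mulr_ge0 ?nrm_ge0.
have nB : 0 < nrm (B y) by rewrite lt_def nrm_eq0 By0 nrm_ge0.
(* |B y|^2 = Re <A (B y), y> <= k |B y| |y|, and the factor |B y| cancels. *)
rewrite -(ler_pM2r nB) -expr2 -rdotxx /rdot -AB -/(rdot _ _).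
apply: le_trans (ler_norm _) _; apply: le_trans (rdot_le _ _) _.
by rewrite mulrAC ler_wpM2r ?nrm_ge0.
Qed.

Lemma bounded_adjoint A : bounded_operator A -> bounded_operator (adjoint A).
Proof. by move=> bA; apply: bounded_adjoint_pair (adjointP bA). Qed.

Lemma kernel_adjoint_pair A B z : adjoint_pair A B ->
  orthogonal_to (range A) z -> B z = 0.
Proof.
move=> AB zA; apply: inner_eq0; rewrite -AB; apply: inner_eq0C.
by apply: zA; exists (B z).
Qed.

Lemma range_ortho_kernel A B : adjoint_pair A B -> linear B ->
  forall x, orthogonal_to (op_kernel B) (A x).
Proof. by move=> AB linB x y By; rewrite AB By inner0r. Qed.

Lemma kernel_decomp A x : bounded_operator A ->
  exists2 y, orthogonal_to (op_kernel A) y & op_kernel A (x - y).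
Proof.
move=> bA; have subK := lin_subspace_kernel bA.1.
have [p [Kp pK]] := projection_exists subK x (closed_kernel bA).
by exists (x - p) => //; rewrite opprB addrC subrK.
Qed.

(* A map bounded below carries Cauchy sequences of values back to Cauchy
   sequences of arguments. *)
Lemma closed_image A M k : bounded_operator A -> lin_subspace M -> closed M ->
  (forall x, M x -> nrm x <= k * nrm (A x)) -> closed (A @` M).
Proof.
move=> bA subM clM Mk.
have [linA [b b0 Ab]] := (bounded_operatorP A).1 bA.
have half01 : 0 <= (2^-1 : R) < 1 by rewrite invr_ge0 ler0n invf_lt1// ltr1n.
have h0 n : 0 < (2^-1 : R) ^+ n by rewrite exprn_gt0// invr_gt0.
apply: closed_nrmP => y yA.
have /choice[u uP] n : exists m, M m /\ nrm (y - A m) <= 2^-1 ^+ n.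
  by have [_ [m Mm <-] ym] := yA _ (h0 n); exists m; split => //; exact: ltW.
have Mu n := (uP n).1.
have k0 : 0 <= Num.max k 0 by rewrite le_max lexx orbT.
have {}Mk x : M x -> nrm x <= Num.max k 0 * nrm (A x).
  move=> /Mk /le_trans; apply.
  by rewrite ler_wpM2r ?nrm_ge0// le_max lexx.
have uC n : nrm (u n.+1 - u n) <= (Num.max k 0 * 2) * 2^-1 ^+ n.
  apply: le_trans (Mk _ (lin_subspaceB subM (Mu _) (Mu _))) _.
  rewrite -mulrA ler_wpM2l// opB//.
  apply: le_trans (nrm_dist y _ _) _; rewrite mulr2n mulrDl mul1r.
  apply: lerD; last exact: (uP n).2.
  rewrite nrmBC; apply: le_trans (uP n.+1).2 _.
  by rewrite exprS ler_piMl// ?ltW//; case/andP: half01.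
have [p pu] := geometric_cauchy half01 uC.
exists p.
  apply: closed_nrm clM _ => e e0.
  apply: contrapT => /forall2NP H0.
  suff : e <= 0 by rewrite leNgt e0.
  apply: (@ler_geometric _ _ _ (Num.max k 0 * 2 / (1 - 2^-1)) _ half01) => n.
  rewrite add0r.
  have [//|] := H0 (u n).
  by move/negP; rewrite -leNgt => /le_trans; apply; exact: pu.
apply/subr0_eq/nrm_le_eq0.
apply: (@ler_geometric _ _ _ (b * (Num.max k 0 * 2 / (1 - 2^-1)) + 1) _ half01) => n.
rewrite add0r mulrDl mul1r.
apply: le_trans (nrm_dist (A (u n)) _ _) _; apply: lerD; last first.
  by rewrite nrmBC; exact: (uP n).2.
by rewrite -opB//; apply: le_trans (Ab _) _; rewrite -[leRHS](mulrA b) ler_wpM2l.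
Qed.

(** The image of N(A)^perp is closed by [closed_image]. The residual of projecting [y] onto it is
    orthogonal to the range of [A], hence in N(A), but it also lies in N(A)^perp, so it vanishes. *)
Lemma selfadjoint_range A k : bounded_operator A -> adjoint_pair A A ->
  (forall x, orthogonal_to (op_kernel A) x -> nrm x <= k * nrm (A x)) ->
  forall y, orthogonal_to (op_kernel A) y ->
  exists2 x, orthogonal_to (op_kernel A) x & A x = y.
Proof.
move=> bA AA Ak y yA.
have subM := lin_subspace_ortho (op_kernel A).
have clM := @closed_ortho (op_kernel A).
have clA := closed_image bA subM clM Ak.
have subA := lin_subspace_image bA.1 subM.
have [_ [[x xK <-] pA]] := projection_exists subA y clA.
exists x => //; apply/esym/subr0_eq.
have yAx : orthogonal_to (op_kernel A) (y - A x).
  apply: (lin_subspaceB subM) => //.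
  exact: (range_ortho_kernel AA bA.1).
apply: (ortho_disjoint _ yAx); apply: (kernel_adjoint_pair AA) => _ [z _ <-].
have [w wK zw] := kernel_decomp z bA.
have -> : A z = A w by apply/subr0_eq; rewrite -(opB bA.1).
by apply: pA; exists w.
Qed.

End BoundedOperators.

(** * Operators with closed range *)

Section ClosedRange.
Variables (R : realType) (H : hilbertType R).
Implicit Types (x y z : H) (a : R[i]) (k : R) (M E : set H) (A B : H -> H).

(* Gliding hump: adding [+/- 3 ^- n] times the direction of [v n] at step [n] makes
   [rdot l (v n)] at least [3 ^- n * nrm (v n) / 2] in the limit [l]. *)
Lemma weakly_bounded E :
  (forall x, exists K, forall v, E v -> `|rdot x v| <= K) ->
  exists K, forall v, E v -> nrm v <= K.
Proof.
move=> Ewb; apply: contrapT => /forallNP Eub.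
pose q : R := 3^-1.
have q0 : 0 < q by rewrite invr_gt0.
have q01 : 0 <= q < 1 by rewrite ltW//= invf_lt1// ltr1n.
have qn0 n : 0 < q ^+ n by rewrite exprn_gt0.
(* The growth n 3^n makes q^n |v_n| exceed [n], which contradicts any bound [K]. *)
have /choice[v vP] n : exists v, E v /\ n%:R / q ^+ n < nrm v.
  have /existsNP[v /not_implyP[Ev /negP]] := Eub (n%:R / q ^+ n).
  by rewrite -ltNge; exists v.
have Ev n := (vP n).1.
have nv n : 0 < nrm (v n).
  by apply: le_lt_trans (vP n).2; rewrite divr_ge0// ltW.
have /choice[f fP] (p : nat * H) : exists y,
    nrm (y - p.2) <= q ^+ p.1 /\ q ^+ p.1 * nrm (v p.1) <= `|rdot y (v p.1)|.
  case: p => n x /=.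
  pose w := (q ^+ n / nrm (v n))%:C *: v n.
  have nw : nrm w = q ^+ n.
    by rewrite nrmZr ger0_norm ?divr_ge0 ?nrm_ge0// ?ltW// divfK// gt_eqF.
  have dw : rdot w (v n) = q ^+ n * nrm (v n).
    by rewrite rdotZl rdotxx expr2 mulrA divfK// gt_eqF.
  (* The sign of the added vector is that of [rdot x (v n)], so the two terms do not cancel. *)
  have [xv|xv] := leP 0 (rdot x (v n)).
    exists (x + w); rewrite addrC addKr nw; split => //.
    rewrite rdotDl dw; apply: le_trans (ler_norm _).
    by rewrite lerDr.
  exists (x - w); rewrite addrC addKr nrmN nw; split => //.
  rewrite rdotDl rdotNl dw -normrN; apply: le_trans (ler_norm _).
  by rewrite opprD opprK lerDr oppr_ge0 ltW.
pose u := fix u n := if n is m.+1 then f (m, u m) else 0.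
have uC n : nrm (u n.+1 - u n) <= 1 * q ^+ n.
  by rewrite mul1r; have [] := fP (n, u n).
have [l lu] := geometric_cauchy q01 uC.
have [K lK] := Ewb l.
suff nK n : n%:R <= 2 * K.
  by have := truncnS_gt (2 * K); rewrite ltNge nK.
have h : q ^+ n * nrm (v n) <= 2 * `|rdot l (v n)|.
  have [_ /= uv] := fP (n, u n).
  rewrite -/(u n.+1) in uv.
  have -> : l = u n.+1 + (l - u n.+1) by rewrite addrC subrK.
  rewrite rdotDl.
  (* The steps after the n-th add up to at most q^(n+1) / (1 - q) = q^n / 2, half of what step [n]
     secured. *)
  have dl : `|rdot (l - u n.+1) (v n)| <= 2^-1 * (q ^+ n * nrm (v n)).
    apply: le_trans (rdot_le _ _) _; rewrite mulrA ler_wpM2r ?nrm_ge0//.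
    apply: le_trans (lu _) _; rewrite exprS le_eqVlt; apply/orP; left; apply/eqP.
    by rewrite /q; field.
  have := lerB_normD (rdot (u n.+1) (v n)) (rdot (l - u n.+1) (v n)).
  move: dl uv; move: (q ^+ n * _) `|rdot (u _) _| `|rdot (l - _) _| `|_ + _|.
  by move=> *; lra.
have := (vP n).2; rewrite ltr_pdivrMr// mulrC => /ltW/le_trans; apply.
by apply: le_trans h _; rewrite ler_wpM2l// lK.
Qed.

Variable T : H -> H.
Hypothesis crT : closed_range T.
Let bT : bounded_operator T := crT.1.
Let linT := bT.1.
Let TT := adjointP bT.
Let bT' := bounded_adjoint bT.

(** Uniform boundedness for the [v] in the range with |T^* v| <= 1: if [T x] is the projection of
    [h] onto the range, then Re <h, v> = Re <x, T^* v> has absolute value at most |x|. Homogeneity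
    extends the estimate to all [v]. *)
Lemma adjoint_bounded_below : exists2 C, 0 <= C &
  forall v, range T v -> nrm v <= C * nrm (adjoint T v).
Proof.
have [|K EK] := @weakly_bounded [set v | range T v /\ nrm (adjoint T v) <= 1].
  move=> h; have [_ [[x _ <-] pT]] :=
    projection_exists (lin_subspace_range linT) h crT.2.
  exists (nrm x) => v [Tv v1].
  have -> : rdot h v = rdot x (adjoint T v).
    rewrite /rdot -TT; congr complex.Re; apply/subr0_eq.
    by rewrite -innerBl pT.
  apply: le_trans (rdot_le _ _) _.
  by rewrite -[leRHS]mulr1 ler_wpM2l// nrm_ge0.
have K0 : 0 <= K.
  apply: le_trans (nrm_ge0 0) (EK 0 _); split; last by rewrite (op0 bT'.1) nrm0.
  by exists 0 => //; exact: op0.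
exists K => // v Tv; have [v0|v0] := eqVneq (adjoint T v) 0.
  (* Here [v] is both in the range and orthogonal to it. *)
  rewrite (_ : v = 0) ?nrm0 ?mulr_ge0 ?nrm_ge0//.
  apply: (ortho_disjoint Tv) => _ [x _ <-]; apply: inner_eq0C.
  by rewrite TT v0 inner0r.
have n0 : 0 < nrm (adjoint T v) by rewrite lt_def nrm_eq0 v0 nrm_ge0.
have := EK ((nrm (adjoint T v))^-1%:C *: v).
rewrite nrmZr ger0_norm ?invr_ge0 ?nrm_ge0// mulrC ler_pdivrMr//; apply.
split; first exact: (lin_subspaceZ (lin_subspace_range linT)).
by rewrite (opZ bT'.1) nrmZr ger0_norm ?invr_ge0 ?nrm_ge0// mulVf// gt_eqF.
Qed.

Lemma ler_cancel_self (b d : R) : 0 <= b -> 0 <= d -> b * b <= d * b -> b <= d.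
Proof.
rewrite le_eqVlt => /predU1P[<-//|b0] _.
by rewrite ler_pM2r.
Qed.

(** With G = T T^*, N(G)^perp is the range of [T], and |v|^2 <= C^2 <G v, v> there, so [G v = T x]
    is solvable. Then x = T^* v, and |x|^2 = Re <T x, v> <= C |T x| |x|. *)
Lemma closed_range_bounded_below : exists2 C, 0 <= C &
  forall x, orthogonal_to (op_kernel T) x -> nrm x <= C * nrm (T x).
Proof.
have [C C0 CT'] := adjoint_bounded_below.
have bG := bounded_comp bT bT'.
have GG : adjoint_pair (T \o adjoint T) (T \o adjoint T).
  by move=> x y /=; rewrite TT (adjoint_pairC TT).
have Gv v : nrm (adjoint T v) ^+ 2 = rdot (T (adjoint T v)) v.
  by rewrite -rdotxx /rdot TT.
have rangeG v : orthogonal_to (op_kernel (T \o adjoint T)) v -> range T v.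
  move=> vG; apply: (ortho_ortho (lin_subspace_range linT) crT.2) => y yT.
  by apply: vG; rewrite /op_kernel/= (kernel_adjoint_pair TT yT) (op0 linT).
have rangeG' v : range T v -> orthogonal_to (op_kernel (T \o adjoint T)) v.
  move=> [x _ <-] y Gy; rewrite TT; suff -> : adjoint T y = 0 by rewrite inner0r.
  by apply: inner_eq0; rewrite -TT (_ : T (adjoint T y) = 0)// inner0l.
exists C => // x xM.
have TxG : orthogonal_to (op_kernel (T \o adjoint T)) (T x).
  by apply: rangeG'; exists x.
have [|v vG GvTx] := @selfadjoint_range _ _ _ (C ^+ 2) bG GG _ (T x) TxG.
  move=> v /rangeG Tv; apply: ler_cancel_self; rewrite ?mulr_ge0 ?sqr_ge0 ?nrm_ge0//.

  have := CT' v Tv; rewrite -ler_sqr ?nnegrE ?mulr_ge0 ?nrm_ge0// exprMn Gv -expr2.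
  move=> /le_trans; apply; rewrite -mulrA ler_wpM2l ?sqr_ge0//.
  by apply: le_trans (ler_norm _) _; exact: rdot_le.
have xv : x = adjoint T v.
  apply/subr0_eq/(ortho_disjoint (M := op_kernel T)).
    by rewrite /op_kernel/= opB// -GvTx/= subrr.
  apply: (lin_subspaceB (lin_subspace_ortho _)) => //.
  exact: (range_ortho_kernel (adjoint_pairC TT) linT).
apply: ler_cancel_self; rewrite ?mulr_ge0 ?nrm_ge0//.
rewrite -expr2 {1}xv Gv -/((T \o adjoint T) v) GvTx.
apply: le_trans (ler_norm _) _; apply: le_trans (rdot_le _ _) _.
by rewrite -mulrA mulrCA ler_wpM2l ?nrm_ge0// xv CT'//; exact: rangeG.
Qed.

End ClosedRange.

(** * Positive operators and square roots *)

Section SquareRoot.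
Variables (R : realType) (H : hilbertType R).
Implicit Types (x y z : H) (a : R[i]) (k : R) (M E : set H) (A B P : H -> H).

Lemma ler_nrm_sqrt x y k : nrm x ^+ 2 <= k * nrm y ^+ 2 ->
  nrm x <= Num.sqrt k * nrm y.
Proof.
move=> /ler_wsqrtr; rewrite [k * _]mulrC (sqrtrM _ (sqr_ge0 _)).
by rewrite !sqrtr_sqr !ger0_norm ?nrm_ge0// mulrC.
Qed.

Lemma adjoint_pair_linear A B : adjoint_pair A B -> linear B.
Proof.
move=> AB a x y; apply: inner_inj => z.
by rewrite -AB !innerDr !innerZr !AB.
Qed.

Lemma adjoint_pair_real A x : adjoint_pair A A -> inner (A x) x = (rdot (A x) x)%:C.
Proof.
move=> AA; rewrite /rdot.
have : inner (A x) x = conjc (inner (A x) x) by rewrite -innerC AA.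
by case: (inner (A x) x) => u v /= [/eqP]; rewrite -addr_eq0 -mulr2n mulrn_eq0/= => /eqP ->.
Qed.

(** Polarization: [inner (A z) z] is real, and its values at z = x + y and z = x + i y give the two
    coordinates of the identity. *)
Lemma positive_adjoint_pair A : positive_operator A -> adjoint_pair A A.
Proof.
move=> [[linA _] A0].
have Im0 x : complex.Im (inner (A x) x) = 0 by apply: ger0_Im.
move=> x y; rewrite (innerC (A y) x).
have := Im0 (x + y); have := Im0 (x + 'i *: y).
rewrite !(opD linA) !(opZ linA) !innerDl !innerDr !innerZl !innerZr.
have := Im0 y; have := Im0 x.
case: (inner (A x) x) => a1 a2 /= h2; case: (inner (A y) y) => b1 b2 /= h1.
case: (inner (A x) y) => c1 c2; case: (inner (A y) x) => d1 d2 /=.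
subst a2 b2 => h3 h4; apply/eqP; rewrite eq_complex /=.
by apply/andP; split; apply/eqP; lra.
Qed.

(** Comes from positivity at x - A x / s with s = |A|, together with <A (A x), A x> <= s |A x|^2; no
    square root of [A] is involved. *)
Lemma positive_nrm_sq A x : positive_operator A ->
  nrm (A x) ^+ 2 <= opnorm A * rdot (A x) x.
Proof.
move=> posA; have [bA A0] := posA; have AA := positive_adjoint_pair posA.
have := opnorm_ge0 bA; rewrite le_eqVlt => /predU1P[s0|s0].
  have := opnorm_ub bA x; rewrite -s0 !mul0r => /nrm_le_eq0 ->.
  by rewrite nrm0 expr0n.
set s := opnorm A in s0 *.
have : 0 <= rdot (A (x - (s^-1)%:C *: A x)) (x - (s^-1)%:C *: A x).
  by rewrite -ler0c -adjoint_pair_real.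
rewrite (opB bA.1) (opZ bA.1) !rdotDl !rdotDr !rdotNl !rdotNr !rdotZl !rdotZr.
have -> : rdot (A (A x)) x = nrm (A x) ^+ 2 by rewrite /rdot AA -/(rdot _ _) rdotxx.
rewrite rdotxx.
have h : rdot (A (A x)) (A x) <= s * nrm (A x) ^+ 2.
  apply: le_trans (ler_norm _) _; apply: le_trans (rdot_le _ _) _.
  by rewrite expr2 mulrA ler_wpM2r ?nrm_ge0//; exact: opnorm_ub.
move=> h0; have {}h : s^-1 * (s^-1 * rdot (A (A x)) (A x)) <= s^-1 * nrm (A x) ^+ 2.
  by rewrite ler_pM2l ?invr_gt0// ler_pdivrMl.
rewrite -ler_pdivrMl//.
by move: h h0; move: (rdot _ x) (s^-1 * nrm _ ^+ 2) (s^-1 * (s^-1 * _)) => *; lra.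
Qed.

(* Expand the square and bound [nrm (A y) ^+ 2] by [k * rdot (A y) y]. *)
Lemma strict_contraction A M (k c t : R) : 0 < c -> 0 < t -> t * k < 2 ->
  (forall y, nrm (A y) ^+ 2 <= k * rdot (A y) y) ->
  (forall y, M y -> c * nrm y ^+ 2 <= rdot (A y) y) ->
  exists2 q, 0 <= q < 1 & forall y, M y -> nrm (y - t%:C *: A y) <= q * nrm y.
Proof.
(* From |y - t A y|^2 <= |y|^2 - t (2 - t k) <A y, y>. The radicand may be negative if [M] has no
   nonzero vector; [Num.sqrt] is then 0 and the bound still holds. *)
move=> c0 t0 tk Ak Ac; exists (Num.sqrt (1 - t * (2 - t * k) * c)).
  rewrite sqrtr_ge0/= -[ltRHS]sqrtr1 ltr_sqrt// ltrBlDr ltrDl.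
  by rewrite !mulr_gt0// subr_gt0.
move=> y My; apply: ler_nrm_sqrt.
rewrite nrmB_sq rdotZr rdotC nrmZr exprMn real_normK ?num_real//.
have h1 := Ak y; have h2 := Ac y My.
have h3 : t ^+ 2 * nrm (A y) ^+ 2 <= t ^+ 2 * (k * rdot (A y) y).
  by rewrite ler_wpM2l// sqr_ge0.
have h4 : t * (2 - t * k) * (c * nrm y ^+ 2) <= t * (2 - t * k) * rdot (A y) y.
  by rewrite ler_wpM2l// mulr_ge0 ?ltW// subr_gt0.
move: h3 h4; move: (nrm (A y) ^+ 2) (nrm y ^+ 2) (rdot _ _) => *; nra.
Qed.

(** * Orthogonal projection onto a closed subspace as an operator *)

Section Projection.
Variable M : set H.
Hypotheses (subM : lin_subspace M) (clM : closed M).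
Let P := orthoproj M.

Lemma orthoprojP x : M (P x) /\ orthogonal_to M (x - P x).
Proof.
have /choice[Q QP] := fun y => projection_exists subM y clM.
have ex_proj : exists P, forall x, M (P x) /\ orthogonal_to M (x - P x) by exists Q.
have /= getP := getPex ex_proj.
exact: getP x.
Qed.

Lemma orthoproj_uniq x p : M p -> orthogonal_to M (x - p) -> P x = p.
Proof.
move=> Mp xp; have [MP xP] := orthoprojP x.
apply/subr0_eq/(ortho_disjoint (M := M)); first exact: (lin_subspaceB subM).
have -> : P x - p = (x - p) - (x - P x) by rewrite opprB addrCA addrAC subrr add0r addrC.
exact: (lin_subspaceB (lin_subspace_ortho M)).
Qed.

Lemma orthoproj_id x : M x -> P x = x.
Proof. by move=> Mx; apply: orthoproj_uniq => // y _; rewrite subrr inner0l. Qed.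

Lemma adjoint_pair_orthoproj : adjoint_pair P P.
Proof.
move=> x y; have [MPx xP] := orthoprojP x; have [MPy yP] := orthoprojP y.
transitivity (inner (P x) (P y)).
  apply/subr0_eq; rewrite -innerBr; apply: inner_eq0C.
  exact: yP.
by apply/esym/subr0_eq; rewrite -innerBl xP.
Qed.

Lemma nrm_orthoproj_sq x : nrm (P x) ^+ 2 = rdot (P x) x.
Proof.
have [MPx xP] := orthoprojP x.
by rewrite -rdotxx /rdot adjoint_pair_orthoproj orthoproj_id// -adjoint_pair_orthoproj.
Qed.

Lemma nrm_orthoproj x : nrm (P x) <= nrm x.
Proof.
have := ler_norm (rdot (P x) x) => /le_trans/(_ (rdot_le _ _)).
rewrite -nrm_orthoproj_sq expr2.
have [->|n0] := eqVneq (nrm (P x)) 0; first by rewrite nrm_ge0.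
by rewrite ler_pM2l// lt_def n0 nrm_ge0.
Qed.

Lemma bounded_orthoproj : bounded_operator P.
Proof.
apply/bounded_operatorP; split.
  exact: adjoint_pair_linear adjoint_pair_orthoproj.
by exists 1 => // x; rewrite mul1r nrm_orthoproj.
Qed.

End Projection.

Lemma geometric_eq0 x (K q : R) : 0 <= q < 1 ->
  (forall n, nrm x <= K * q ^+ n) -> x = 0.
Proof.
move=> q01 xK; apply: nrm_le_eq0; apply: (ler_geometric (C := K) q01) => n.
by rewrite add0r.
Qed.

(* The iteration [B n.+1 = (C + B n ^ 2) / 2] starting at [0] is a contraction on
   the ball of radius [r = (1 + q) / 2]; its limit [B] satisfies
   [(P - B) ^ 2 = P - C]. *)
Section Iteration.
Variables (P C : H -> H) (q : R).
Hypotheses (q01 : 0 <= q < 1) (bP : bounded_operator P) (PP : adjoint_pair P P) (PK : forall x, P (P x) = P x)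
  (CC : adjoint_pair C C) (CP : forall x, C (P x) = C x)
  (Cq : forall x, nrm (C x) <= q * nrm x).

Fixpoint sqrt_iter n : H -> H :=
  if n is m.+1 then
    fun x => (2^-1 : R)%:C *: (C x + sqrt_iter m (sqrt_iter m x))
  else fun=> 0.

Let r := (1 + q) / 2.

Let r01 : 0 <= r < 1.
Proof. by case/andP: q01 => ? ?; apply/andP; split; rewrite /r; lra. Qed.

Let r0 : 0 <= r. Proof. by case/andP: r01. Qed.

(** Makes the ball of radius [r] invariant under the recursion; the gap between the two sides is (1
    - q) (3 + q) / 8. *)
Let qr : 2^-1 * (q + r * r) <= r.
Proof.
case/andP: q01 => q0 q1; rewrite /r.
have : (1 - q) * (1 - q) >= 0 by rewrite -expr2 sqr_ge0.
by nra.
Qed.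

Lemma half_nrm x : nrm ((2^-1 : R)%:C *: x) = 2^-1 * nrm x.
Proof. by rewrite nrmZr ger0_norm// invr_ge0. Qed.

Lemma adjoint_pair_sqrt_iter n : adjoint_pair (sqrt_iter n) (sqrt_iter n).
Proof.
elim: n => [|n IHn] x y /=; first by rewrite inner0l inner0r.
by rewrite innerZl innerZr innerDl innerDr conjc_real CC !IHn.
Qed.

Let lin_iter n : linear (sqrt_iter n).
Proof. exact: adjoint_pair_linear (adjoint_pair_sqrt_iter n). Qed.

Lemma sqrt_iter_proj n x : sqrt_iter n (P x) = sqrt_iter n x.
Proof. by elim: n x => [|n IHn] x //=; rewrite CP IHn. Qed.

Lemma sqrt_iter_le n x : nrm (sqrt_iter n x) <= r * nrm x.
Proof.
elim: n x => [|n IHn] x /=; first by rewrite nrm0 mulr_ge0 ?nrm_ge0.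
rewrite half_nrm.
have h1 := nrmD (C x) (sqrt_iter n (sqrt_iter n x)).
have h2 := Cq x.
have h3 : nrm (sqrt_iter n (sqrt_iter n x)) <= r * r * nrm x.
  by apply: le_trans (IHn _) _; rewrite -mulrA ler_wpM2l.
have h4 : 2^-1 * (q + r * r) * nrm x <= r * nrm x by rewrite ler_wpM2r ?nrm_ge0.
apply: le_trans h4; rewrite -mulrA ler_wpM2l ?invr_ge0//.
by apply: le_trans h1 _; rewrite mulrDl; exact: lerD.
Qed.

Lemma sqrt_iter_step n x : nrm (sqrt_iter n.+1 x - sqrt_iter n x) <= nrm x * r ^+ n.
Proof.
elim: n x => [|n IHn] x.
  by have := sqrt_iter_le 1 x; rewrite subr0 expr0 mulr1 => /le_trans; apply;
     case/andP: r01 => _ /ltW r1; rewrite ler_piMl ?nrm_ge0.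
rewrite [sqrt_iter n.+2 x]/= -/(sqrt_iter n.+1).
rewrite [X in _ - X]/=; set u := sqrt_iter n.+1; set v := sqrt_iter n.
rewrite -scalerBr half_nrm.
(* u^2 - v^2 = u (u - v) + (u - v) v holds without commutation; the induction hypothesis serves at
   [x] and at [v x]. *)
have -> : C x + u (u x) - (C x + v (v x)) = u (u x - v x) + (u (v x) - v (v x)).
  have -> : u (u x - v x) = u (u x) - u (v x) by exact: (opB (@lin_iter n.+1)).
  by rewrite addrA subrK opprD addrACA subrr add0r.
have h1 : nrm (u (u x - v x)) <= r * (nrm x * r ^+ n).
  by apply: le_trans (sqrt_iter_le _ _) _; rewrite ler_wpM2l// IHn.
have h2 : nrm (u (v x) - v (v x)) <= r * nrm x * r ^+ n.
  apply: le_trans (IHn _) _; rewrite ler_wpM2r ?exprn_ge0//.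
  exact: sqrt_iter_le.
have h3 := nrmD (u (u x - v x)) (u (v x) - v (v x)).
rewrite exprS; move: h1 h2; rewrite -mulrA mulrCA.
by move: h3; move: (nrm x * (r * _)) (nrm (_ + _)) => *; lra.
Qed.

Lemma sqrt_one_sub : exists S, [/\ positive_operator S,
  forall x, S (S x) = P x - C x & forall x, S (P x) = S x].
Proof.
have /choice[B Blim] x : exists l, forall n,
    nrm (l - sqrt_iter n x) <= nrm x / (1 - r) * r ^+ n.
  by apply: geometric_cauchy => // n; exact: sqrt_iter_step.
have nx0 x n : 0 <= nrm x / (1 - r) * r ^+ n.
  by apply: le_trans (nrm_ge0 _) (Blim x n).
have BB : adjoint_pair B B.
  move=> x y; apply/subr0_eq/eqP; rewrite -normr_le0 normcRe (lecR _ 0).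
  apply: (@ler_geometric _ _ _ (nrm x / (1 - r) * nrm y + nrm x * (nrm y / (1 - r))) _ r01).
  move=> n; rewrite add0r mulrDl -lecR -normcRe.
  have -> : inner (B x) y - inner x (B y) =
      inner (B x - sqrt_iter n x) y - inner x (B y - sqrt_iter n y).
    by rewrite innerBl innerBr adjoint_pair_sqrt_iter opprB addrA subrK.
  apply: le_trans (ler_normB _ _) _; rewrite rmorphD/=.
  apply: lerD; apply: le_trans (CauchySchwarz_inner _ _) _; rewrite lecR.
    by rewrite mulrAC ler_wpM2r ?nrm_ge0.
  by rewrite -mulrA ler_wpM2l ?nrm_ge0.
have linB : linear B := adjoint_pair_linear BB.
have BP x : B (P x) = B x.
  apply/subr0_eq/(@geometric_eq0 _ (nrm (P x) / (1 - r) + nrm x / (1 - r)) r r01) => n.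
  rewrite mulrDl; apply: le_trans (nrm_dist (sqrt_iter n x) _ _) _; apply: lerD.
    by rewrite -(sqrt_iter_proj n x); exact: Blim.
  by rewrite nrmBC; exact: Blim.
have Ble x : nrm (B x) <= r * nrm x.
  apply: (@ler_geometric _ _ _ (nrm x / (1 - r)) _ r01) => n.
  rewrite -[B x](subrK (sqrt_iter n x)) addrC.
  apply: le_trans (nrmD _ _) _; apply: lerD => //; exact: sqrt_iter_le.
have PB x : P (B x) = B x by apply: inner_inj => z; rewrite -PP -!BB BP.
have BfixE x : B x = (2^-1 : R)%:C *: (C x + B (B x)).
  (* [K] adds the error of [sqrt_iter n.+1] at [x] to half of those coming from [sqrt_iter n] at [x]
     and at [B x], split as in [sqrt_iter_step]. *)
  pose K := nrm x / (1 - r) + 2^-1 * (r * (nrm x / (1 - r)) + nrm (B x) / (1 - r)).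
  apply/subr0_eq/(@geometric_eq0 _ K r r01) => n.
  apply: le_trans (nrm_dist (sqrt_iter n.+1 x) _ _) _; rewrite mulrDl; apply: lerD.
    apply: le_trans (Blim x n.+1) _; rewrite exprS mulrCA ler_piMl//.
    by case/andP: r01 => _ /ltW.
  rewrite /= -scalerBr half_nrm -mulrA ler_wpM2l ?invr_ge0//.
  set Bn := sqrt_iter n.
  have -> : C x + Bn (Bn x) - (C x + B (B x)) =
      Bn (Bn x - B x) + (Bn (B x) - B (B x)).
    have -> : Bn (Bn x - B x) = Bn (Bn x) - Bn (B x) by exact: (opB (@lin_iter n)).
    by rewrite addrA subrK opprD addrACA subrr add0r.
  rewrite mulrDl; apply: le_trans (nrmD _ _) _; apply: lerD.
    apply: le_trans (sqrt_iter_le _ _) _; rewrite -mulrA ler_wpM2l//.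
    by rewrite nrmBC; exact: Blim.
  by rewrite nrmBC; exact: Blim.
have linP := bP.1.
have bB : bounded_operator B by apply/bounded_operatorP; split => //; exists r.
have SS : adjoint_pair (P \- B) (P \- B).
  by move=> x y /=; rewrite innerBl innerBr PP BB.
have SP x : (P \- B) (P x) = (P \- B) x by rewrite /= PK BP.
exists (P \- B); split => //; last first.
  (* As P B = B P = B, the square of P - B is P - 2 B + B^2, and the fixed-point equation turns it
     into P - C. *)
  move=> x /=; rewrite (opB linP) (opB linB) PK PB BP.
  have BxE : B x + B x = C x + B (B x).
    rewrite [in LHS]BfixE -scalerDl -rmorphD/=.
    by rewrite (_ : 2^-1 + 2^-1 = 1 :> R) ?scale1r//; field.
  have -> : B (B x) = B x - C x + B x by rewrite addrAC BxE addrC addKr.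
  by rewrite opprB addrK addrA subrK.
split; first exact: bounded_sub.
(* The form takes the same value at [P x] as at [x]; at [P x] the operator is the identity minus
   [B], with |B| <= r < 1. *)
move=> x; rewrite adjoint_pair_real// ler0c -SP /rdot SS -SP -/(rdot _ _).
rewrite /= !PK rdotDr rdotNr rdotxx subr_ge0.
apply: le_trans (ler_norm _) _; apply: le_trans (rdot_le _ _) _.
rewrite expr2 ler_wpM2l ?nrm_ge0//; apply: le_trans (Ble _) _.
by rewrite ler_piMl ?nrm_ge0//; case/andP: r01 => _ /ltW.
Qed.

End Iteration.

(** C = P - A / c has norm at most [q]; the root of A / c = P - C is rescaled by the square root of
    [c]. *)
Lemma sqrt_exists A P (q c : R) : 0 < c -> 0 <= q < 1 -> bounded_operator P ->
  adjoint_pair P P -> (forall x, P (P x) = P x) ->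
  bounded_operator A -> adjoint_pair A A -> (forall x, A (P x) = A x) ->
  (forall x, nrm (P x - (c^-1)%:C *: A x) <= q * nrm x) ->
  exists S, positive_operator S /\ S \o S = A.
Proof.
move=> c0 q01 bP PP PK bA AA AP Aq.
have PA x : P (A x) = A x by apply: inner_inj => z; rewrite -PP -!AA AP.
pose C x := P x - (c^-1)%:C *: A x.
have CC : adjoint_pair C C.
  by move=> x y; rewrite /C innerBl innerBr PP innerZl innerZr conjc_real AA.
have CP x : C (P x) = C x by rewrite /C PK AP.
have [S [[bS S0] SS _]] := sqrt_one_sub q01 bP PP PK CC CP Aq.
have [linS [k k0 Sk]] := (bounded_operatorP S).1 bS.
exists (fun x => (Num.sqrt c)%:C *: S x); split.
  split.
    apply/bounded_operatorP; split.
      by move=> a x y; rewrite linS scalerDr !scalerA [_ * a]mulrC.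
    exists (Num.sqrt c * k); first by rewrite mulr_ge0// sqrtr_ge0.
    by move=> x; rewrite nrmZr ger0_norm ?sqrtr_ge0// -mulrA ler_wpM2l ?sqrtr_ge0.
  by move=> x; rewrite innerZl mulr_ge0// ler0c sqrtr_ge0.
apply/funext => x /=; rewrite (opZ linS) scalerA -rmorphM/= -expr2 sqr_sqrtr ?ltW//.
rewrite SS /C opprB addrC subrK scalerA -rmorphM/= divff ?scale1r//.
by rewrite gt_eqF.
Qed.

End SquareRoot.

(** * Spectra of self-adjoint operators *)

Section Spectrum.
Variables (R : realType) (H : hilbertType R).
Implicit Types (x y z : H) (a : R[i]) (k : R) (M E : set H) (A B P : H -> H).

(** Expanding |x + y|^2 yields the real parts; replacing [y] by ['i *: y] yields the imaginary
    ones. *)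
Lemma polarization A B : linear A -> linear B ->
  (forall x, nrm (A x) = nrm (B x)) ->
  forall x y, inner (A x) (A y) = inner (B x) (B y).
Proof.
move=> linA linB AB.
have rAB x y : rdot (A x) (A y) = rdot (B x) (B y).
  have := AB (x + y); rewrite (opD linA) (opD linB).
  move=> /(congr1 (fun r => r ^+ 2)); rewrite !nrmD_sq !AB.
  by move=> /addIr/addrI; apply: mulfI; rewrite pnatr_eq0.
move=> x y; apply/eqP; rewrite eq_complex; apply/andP; split; apply/eqP.
  exact: rAB.
by rewrite -!rdotZi -(opZ linA) -(opZ linB) rAB.
Qed.

Lemma orthoproj_ortho_kernel A x : bounded_operator A ->
  A (orthoproj (orthogonal_to (op_kernel A)) x) = A x.
Proof.
move=> bA.
have [_ xP] := orthoprojP (lin_subspace_ortho _) (@closed_ortho _ _ (op_kernel A)) x.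
apply/esym/subr0_eq; rewrite -(opB bA.1).
exact: (ortho_ortho (lin_subspace_kernel bA.1) (closed_kernel bA) xP).
Qed.

(** With [d] the gap, a - A and conj a - A are both bounded below by [d]. The first bound makes a -
    A injective with closed range; the second makes that range dense, its orthogonal complement
    being the kernel of conj a - A. *)
Lemma selfadjoint_resolvent A a : bounded_operator A -> adjoint_pair A A ->
  opnorm A < complex.Re `|a| -> ~ spectrum A a.
Proof.
move=> bA AA Aa; apply; have linA := bA.1.
pose L x := a *: x - A x.
have linL : linear L.
  move=> b x y; rewrite /L linA scalerDr scalerBr opprD addrACA; congr (_ - _ + _).
  by rewrite !scalerA mulrC.
pose d := complex.Re `|a| - opnorm A.
have d0 : 0 < d by rewrite subr_gt0.
have dL b x : complex.Re `|b| = complex.Re `|a| -> d * nrm x <= nrm (b *: x - A x).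
  move=> ba; have := nrm_dist (A x) (b *: x) 0; rewrite !subr0 nrmZ ba.
  by have := opnorm_ub bA x; rewrite /d; move=> *; lra.
have bL : bounded_operator L.
  apply/bounded_operatorP; split => //; exists (complex.Re `|a| + opnorm A).
    by rewrite addr_ge0 ?opnorm_ge0// -ler0c -normcRe.
  move=> x; apply: le_trans (nrmD _ _) _; rewrite nrmN nrmZ mulrDl lerD2l.
  exact: opnorm_ub.
have Lge x : nrm x <= d^-1 * nrm (L x) by rewrite ler_pdivlMl// dL.
have injL x y : L x = L y -> x = y.
  move=> Lxy; apply/subr0_eq/nrm_le_eq0; apply: le_trans (Lge _) _.
  by rewrite (opB linL) Lxy subrr nrm0 mulr0.
have subT : lin_subspace [set: H] by [].
have clL : closed (range L) by apply: (closed_image bL subT closedT).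
have surjL y : range L y.
  apply: (ortho_ortho (lin_subspace_range linL) clL) => z zL.
  suff -> : z = 0 by exact: inner0r.
  apply: nrm_le_eq0; rewrite -(pmulr_rle0 _ d0).
  apply: le_trans (dL (conjc a) z _) _; first by rewrite normcJ.
  suff -> : conjc a *: z - A z = 0 by rewrite nrm0.
  apply: inner_inj => x; rewrite inner0r innerBr innerZr conjcK -AA.
  by rewrite -innerZl -innerBl; apply: inner_eq0C; apply: zL; exists x.
have /choice[B LB] y : exists x, L x = y by have [x _ <-] := surjL y; exists x.
exists B; split; last by move=> x; exact: LB.
  apply/bounded_operatorP; split.
    by move=> b x y; apply: injL; rewrite linL !LB.
  by exists d^-1; [rewrite invr_ge0 ltW|move=> x; rewrite -{2}(LB x)].
by move=> x; apply: injL; rewrite LB.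
Qed.

Lemma selfadjoint_spectrum_le A a : bounded_operator A -> adjoint_pair A A ->
  spectrum A a -> complex.Re `|a| <= opnorm A.
Proof. by move=> bA AA sa; rewrite leNgt; apply/negP => /selfadjoint_resolvent; apply. Qed.

Lemma selfadjoint_spectral_radius_le A : bounded_operator A -> adjoint_pair A A ->
  spectral_radius A <= opnorm A.
Proof.
move=> bA AA; rewrite /spectral_radius; set E := image _ _.
(* For an empty spectrum [sup] takes its default value 0. *)
have [E0|/set0P E0] := eqVneq E set0; first by rewrite E0 sup0 opnorm_ge0.
by apply: ge_sup => // _ [a sa <-]; exact: selfadjoint_spectrum_le.
Qed.

Lemma le_spectral_radius A a : bounded_operator A -> adjoint_pair A A ->
  spectrum A a -> complex.Re `|a| <= spectral_radius A.
Proof.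
move=> bA AA sa; apply: ub_le_sup; last by exists a.
by exists (opnorm A) => _ [b sb <-]; exact: selfadjoint_spectrum_le.
Qed.

(* For positive [S], [nrm (S y - s y) ^+ 2 <= s ^+ 2 nrm y ^+ 2 - nrm (S y) ^+ 2]
   with [s = opnorm S], so a bounded inverse of [S - s] would make
   [nrm (S y) / nrm y] stay away from [s]. *)
Lemma opnorm_in_spectrum M S : lin_subspace M -> closed M ->
  positive_operator S -> (forall x, S (orthoproj M x) = S x) -> 0 < opnorm S ->
  spectrum (orthoproj M \- S) (1 - opnorm S)%:C.
Proof.
move=> subM clM posS SP s0; have [bS _] := posS.
set s := opnorm S in s0 *; set P := orthoproj M.
move=> [B [/bounded_operatorP[linB [k k0 Bk]] BL _]].
have k1 : 0 < k + 1 by rewrite ltr_wpDl.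
(* The inverse gives |S y - s y| >= |y| / (k + 1), whose square is the amount lost from s^2; [k + 1]
   stays invertible when k = 0. *)
pose t := s ^+ 2 - ((k + 1) ^+ 2)^-1.
suff : s <= Num.sqrt t.
  rewrite leNgt => /negP; apply.
  rewrite -[ltRHS](ger0_norm (ltW s0)) -sqrtr_sqr ltr_sqrt ?exprn_gt0//.
  by rewrite /t ltrBlDr ltrDl invr_gt0 exprn_gt0.
apply: opnorm_le; first exact: sqrtr_ge0.
move=> x; rewrite -SP; apply: (@le_trans _ _ (Num.sqrt t * nrm (P x))); last first.
  by rewrite ler_wpM2l ?sqrtr_ge0//; exact: nrm_orthoproj.
apply: ler_nrm_sqrt; rewrite -/P.
have [My _] := orthoprojP subM clM x; rewrite -/P in My.
set y := P x in My *.
have Sy : (1 - s)%:C *: y - (P y - S y) = S y - s%:C *: y.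
  rewrite /P orthoproj_id// rmorphB/= scalerBl scale1r opprB addrC.
  by rewrite -addrA addrC -!addrA addKr addrC.
have := BL y; rewrite /= Sy => By.
have ky : nrm y <= (k + 1) * nrm (S y - s%:C *: y).
  rewrite -{1}By; apply: le_trans (Bk _) _.
  by rewrite ler_wpM2r ?nrm_ge0// lerDl.
have {}ky : ((k + 1) ^+ 2)^-1 * nrm y ^+ 2 <= nrm (S y - s%:C *: y) ^+ 2.
  rewrite ler_pdivrMl ?exprn_gt0// -exprMn ler_sqr ?nnegrE ?mulr_ge0 ?nrm_ge0//.
  exact: ltW.
move: ky; rewrite nrmB_sq rdotZr nrmZr exprMn real_normK ?num_real// /t mulrBl.
have := positive_nrm_sq y posS; rewrite -/s.
move: (_^-1 * _) (s * rdot _ _) (s ^+ 2 * _) (nrm (S y) ^+ 2) => *; lra.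
Qed.

End Spectrum.

(** * The polar splitting *)

Section PolarSplitting.
Variables (R : realType) (H : hilbertType R) (T : H -> H).
Hypothesis crT : closed_range T.
Implicit Types x y z : H.

Let bT : bounded_operator T := crT.1.
Let linT := bT.1.
Let M := orthogonal_to (op_kernel T).
Let S := abs_operator T.
Let U := polar_factor T.
Let P := orthoproj M.

Let subM : lin_subspace M. Proof. exact: lin_subspace_ortho. Qed.
Let clM : closed M. Proof. exact: closed_ortho. Qed.
Let MP x : M (P x). Proof. by have [] := orthoprojP subM clM x. Qed.
Let PP : adjoint_pair P P. Proof. exact: adjoint_pair_orthoproj. Qed.
Let linP : linear P. Proof. exact: (bounded_orthoproj subM clM).1. Qed.

(** [closed_range_bounded_below] bounds T^* T from below on [M], so P - T^* T / k has norm below 1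
    and [sqrt_exists] applies. *)
Lemma abs_operatorP : positive_operator S /\ S \o S = adjoint T \o T.
Proof.
suff /getPex : exists S, positive_operator S /\ S \o S = adjoint T \o T by [].
have [K K0 TK] := closed_range_bounded_below crT.
have bT' := bounded_adjoint bT.
have AAx x : rdot (adjoint T (T x)) x = nrm (T x) ^+ 2.
  by rewrite -rdotxx /rdot (adjoint_pairC (adjointP bT)).
(* The added 1 here and in [K + 1] keeps both invertible, even for T = 0. *)
pose k := opnorm (adjoint T) ^+ 2 + 1.
have k0 : 0 < k by rewrite ltr_wpDl// sqr_ge0.
have K1 : 0 < K + 1 by rewrite ltr_wpDl.
have [|||||q q01 Mq] := @strict_contraction _ _ (adjoint T \o T) M k ((K + 1) ^+ 2)^-1 k^-1.
- by rewrite invr_gt0 exprn_gt0.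
- by rewrite invr_gt0.
- by rewrite mulVf ?gt_eqF// ltr1n.
- move=> y /=; rewrite AAx.
  apply: (@le_trans _ _ (opnorm (adjoint T) ^+ 2 * nrm (T y) ^+ 2)).
    rewrite -exprMn ler_sqr ?nnegrE ?mulr_ge0 ?nrm_ge0 ?opnorm_ge0//.
    exact: opnorm_ub.
  by rewrite ler_wpM2r ?sqr_ge0// lerDl.
- move=> y My /=; rewrite AAx ler_pdivrMl ?exprn_gt0// -exprMn.
  rewrite ler_sqr ?nnegrE ?mulr_ge0 ?nrm_ge0//; last exact: ltW.
  apply: le_trans (TK _ My) _.
  by rewrite ler_wpM2r ?nrm_ge0// lerDl.
apply: (@sqrt_exists _ _ _ P q k) => //.
- exact: bounded_orthoproj.
- by move=> x; apply: orthoproj_id.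
- exact: bounded_comp.
- by move=> x y /=; rewrite (adjoint_pairC (adjointP bT)) (adjointP bT).
- by move=> x /=; rewrite orthoproj_ortho_kernel.
- move=> x; have -> : (adjoint T \o T) x = (adjoint T \o T) (P x).
    by rewrite /= orthoproj_ortho_kernel.
  apply: le_trans (Mq _ (MP x)) _; rewrite ler_wpM2l ?nrm_orthoproj//.
  by case/andP: q01.
Qed.

Let posS : positive_operator S. Proof. by case: abs_operatorP. Qed.
Let bS : bounded_operator S. Proof. by case: posS. Qed.
Let SS : adjoint_pair S S. Proof. exact: positive_adjoint_pair. Qed.

Lemma abs_operator_sq x : S (S x) = adjoint T (T x).
Proof. by case: abs_operatorP => _ /(congr1 (fun f => f x)). Qed.

Lemma nrm_abs_operator x : nrm (S x) = nrm (T x).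
Proof.
apply/eqP; rewrite -(eqrXn2 (ltn0Sn 1)) ?nrm_ge0//; apply/eqP.
by rewrite -!rdotxx /rdot -SS abs_operator_sq (adjoint_pairC (adjointP bT)).
Qed.

Lemma kernel_abs_operator : op_kernel S = op_kernel T.
Proof.
apply/seteqP; split => x; rewrite /op_kernel/= => x0; apply: nrm_le_eq0.
  by rewrite -nrm_abs_operator x0 nrm0.
by rewrite nrm_abs_operator x0 nrm0.
Qed.

Let MS x : M (S x).
Proof. by rewrite /M -kernel_abs_operator; exact: (range_ortho_kernel SS bS.1). Qed.

Let SP x : S (P x) = S x.
Proof. by rewrite /P /M -kernel_abs_operator orthoproj_ortho_kernel. Qed.

(** [S] inherits the lower bound of [T] on [M], as |S x| = |T x|. *)
Lemma abs_operator_surj y : M y -> exists2 x, M x & S x = y.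
Proof.
have [K _ TK] := closed_range_bounded_below crT.
rewrite /M -kernel_abs_operator; apply: (@selfadjoint_range _ _ S K) => // x.
by rewrite kernel_abs_operator nrm_abs_operator; exact: TK.
Qed.

(** [W] picks a preimage of [P y] under [S]. This choice need not be linear, but [T \o W] is, since
    [T x] depends only on [S x]; and it is isometric on [M]. *)
Lemma polar_factorP : [/\ partial_isometry U, T = U \o S & op_kernel U = op_kernel T].
Proof.
suff /getPex : exists U,
  [/\ partial_isometry U, T = U \o S & op_kernel U = op_kernel T] by [].
have /choice[W WP] y : exists x, S x = P y.
  by have [x _ <-] := abs_operator_surj (MP y); exists x.
have ST x y : S x = S y -> T x = T y.
  move=> Sxy; apply/subr0_eq/nrm_le_eq0.
  by rewrite -(opB linT) -nrm_abs_operator (opB bS.1) Sxy subrr nrm0.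
have WT y : nrm (T (W y)) = nrm (P y) by rewrite -nrm_abs_operator WP.
have kerW : op_kernel (T \o W) = op_kernel T.
  apply/seteqP; split => x; rewrite /op_kernel/= => x0.
    rewrite -(orthoproj_ortho_kernel x bT) -/P -/M.
    suff -> : P x = 0 by exact: op0.
    by apply: nrm_le_eq0; rewrite -WT x0 nrm0.
  apply: nrm_le_eq0; rewrite WT (_ : P x = 0) ?nrm0//.
  apply: (orthoproj_uniq subM clM); first by case: subM.
  by rewrite subr0; exact: ortho_sub.
exists (T \o W); split => //.
- split.
    apply/bounded_operatorP; split.
      move=> a x y /=; rewrite -linT; apply: ST.
      by rewrite bS.1 !WP linP.
    by exists 1 => // x /=; rewrite mul1r WT; exact: nrm_orthoproj.
  by move=> x; rewrite kerW => Mx /=; rewrite !nrmE WT /P orthoproj_id.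
- apply/funext => x /=; apply: ST.
  by rewrite WP /P orthoproj_id.
Qed.

Let bU : bounded_operator U. Proof. by case: polar_factorP => -[]. Qed.
Let linU := bU.1.
Let TU x : T x = U (S x).
Proof. by case: polar_factorP => _ /(congr1 (fun f => f x)). Qed.
Let kerU : op_kernel U = op_kernel T. Proof. by case: polar_factorP. Qed.

Let UP x : U (P x) = U x.
Proof. by rewrite /P /M -kerU orthoproj_ortho_kernel. Qed.

Lemma nrm_polar_factor x : nrm (U x) = nrm (P x).
Proof.
rewrite -UP; case: polar_factorP => -[_ isoU] _ _.
by rewrite /nrm isoU// -/U kerU; exact: MP.
Qed.

Lemma range_polar_factor : range U = range T.
Proof.
apply/seteqP; split => _ [x _ <-].
  have [y _ Sy] := abs_operator_surj (MP x).
  by exists y => //; rewrite TU Sy UP.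
by exists (S x) => //; rewrite -TU.
Qed.

Lemma range_adjoint : range (adjoint T) = M.
Proof.
have TT := adjoint_pairC (adjointP bT).
apply/seteqP; split => [_ [x _ <-]|x Mx]; first exact: (range_ortho_kernel TT linT).
(* Two uses of surjectivity give x = S (S z) = T^* (T z). *)
have [y My Sy] := abs_operator_surj Mx; have [z _ Sz] := abs_operator_surj My.
by exists (T z) => //; rewrite -abs_operator_sq Sz Sy.
Qed.

Lemma opnorm_abs_operator : opnorm T = opnorm S.
Proof.
rewrite !opnorm_set; congr sup; congr image; apply/funext => x.
by rewrite nrm_abs_operator.
Qed.

Lemma opnorm_polar_sub : opnorm (U \- T) = opnorm (P \- S).
Proof.
rewrite !opnorm_set; congr sup; congr image; apply/funext => x /=.
by rewrite TU -(opB linU) nrm_polar_factor (opB linP) [P (S x)]orthoproj_id.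
Qed.

Lemma adjoint_polar_factorK x : adjoint U (U x) = P x.
Proof.
apply: inner_injl => y; rewrite (adjoint_pairC (adjointP bU)).
rewrite (polarization linU linP nrm_polar_factor).
by rewrite -PP [P (P x)]orthoproj_id.
Qed.

(** * The Moore-Penrose inverse of the polar factor *)

Let B := moore_penrose U.

Lemma moore_penroseP : bounded_operator B /\
  [/\ U \o B \o U = U, B \o U \o B = B,
      adjoint (U \o B) = U \o B & adjoint (B \o U) = B \o U].
Proof.
suff /getPex : exists B, bounded_operator B /\
  [/\ U \o B \o U = U, B \o U \o B = B,
      adjoint (U \o B) = U \o B & adjoint (B \o U) = B \o U] by [].
have bU' := bounded_adjoint bU; have UU := adjointP bU.
have UU' := adjoint_pairC UU.
exists (adjoint U); split => //; split.
- by apply/funext => x /=; rewrite adjoint_polar_factorK UP.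
- apply/funext => x /=; rewrite adjoint_polar_factorK; apply: (orthoproj_id subM clM).
  by rewrite /M -kerU; exact: (range_ortho_kernel UU' linU).
- apply: adjoint_uniq; first exact: bounded_comp.
  by move=> x y /=; rewrite UU UU'.
- apply: adjoint_uniq; first exact: bounded_comp.
  by move=> x y /=; rewrite UU' UU.
Qed.

(** Follows from the Penrose equations: B U is self-adjoint, so its values are orthogonal to N(U),
    and U (x - B (U x)) = 0. *)
Lemma moore_penrose_polar x : B (U x) = P x.
Proof.
have [bB [UBU _ _ adjBU]] := moore_penroseP.
have bBU := bounded_comp bB bU.
have BUBU : adjoint_pair (B \o U) (B \o U) by rewrite -{2}adjBU; exact: adjointP.
have UBUx y : U (B (U y)) = U y by have := congr1 (fun f => f y) UBU.
apply/esym/(orthoproj_uniq subM clM).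
  move=> y; rewrite -kerU => Uy.
  by rewrite [inner _ _]BUBU /= (Uy : U y = 0) (op0 bB.1) inner0r.
apply: ortho_sub; rewrite -kerU /op_kernel/= (opB linU) UBUx subrr //.
Qed.

Lemma moore_penrose_iteration V x : T = U \- V -> B (V x) = P x - S x.
Proof.
move=> TUV; have -> : V x = U (x - S x).
  have /= := congr1 (fun f => f x) TUV; rewrite (opB linU) -TU => ->.
  by rewrite opprB addrC subrK.
by rewrite moore_penrose_polar (opB linP) [P (S x)]orthoproj_id.
Qed.

(** * Norm and spectral radius of [P \- S] against the norm of [T] *)

Let C := P \- S.
Let bC : bounded_operator C.
Proof. by apply: bounded_sub => //; exact: bounded_orthoproj. Qed.
Let CC : adjoint_pair C C.
Proof.
move=> x y; rewrite /C/= innerBl innerBr SS.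
by rewrite PP.
Qed.

Lemma polar_proper_splitting V : T = U \- V -> proper_splitting T U V.
Proof.
move=> TUV; split => //; last exact: range_polar_factor.
have -> : V = U \- T by apply/funext => x; rewrite TUV/= opprB addrC subrK.
exact: bounded_sub.
Qed.

Lemma opnorm_lt2_sub : opnorm T < 2 -> opnorm C < 1.
Proof.
rewrite opnorm_abs_operator => S2.
have [K K0 TK] := closed_range_bounded_below crT.
have K1 : 0 < K + 1 by rewrite ltr_wpDl.
have s1 : 0 < opnorm S + 1 by rewrite ltr_wpDl// opnorm_ge0.
(* Here t = 1 and k = |S| < 2. The constant comes from |y|^2 <= (K + 1)^2 |S y|^2 <= (K + 1)^2 |S|
   <S y, y>, with |S| + 1 in place of |S| to be invertible. *)
have [|||||q /andP[q0 q1] Mq] := @strict_contraction _ _ S M (opnorm S)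
    (((K + 1) ^+ 2)^-1 * (opnorm S + 1)^-1) 1.
- by rewrite mulr_gt0// invr_gt0// exprn_gt0.
- by [].
- by rewrite mul1r.
- by move=> y; exact: positive_nrm_sq.
- move=> y My; rewrite -mulrA ler_pdivrMl ?exprn_gt0// ler_pdivrMl//.
  apply: (@le_trans _ _ ((K + 1) ^+ 2 * nrm (S y) ^+ 2)).
    rewrite -exprMn ler_sqr ?nnegrE ?mulr_ge0 ?nrm_ge0//; last exact: ltW.
    rewrite nrm_abs_operator; apply: le_trans (TK _ My) _.
    by rewrite ler_wpM2r ?nrm_ge0// lerDl.
  rewrite [leRHS]mulrCA ler_wpM2l ?sqr_ge0//; apply: le_trans (positive_nrm_sq y posS) _.
  by rewrite ler_wpM2r ?lerDl// -ler0c -adjoint_pair_real//; case: posS.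
apply: le_lt_trans q1; apply: opnorm_le => // x.
have := Mq _ (MP x); rewrite scale1r SP => /le_trans; apply.
by rewrite ler_wpM2l// nrm_orthoproj.
Qed.

Lemma opnorm_sub_lt2 : opnorm C < 1 -> opnorm T < 2.
Proof.
move=> C1; rewrite opnorm_abs_operator; apply: (@le_lt_trans _ _ (1 + opnorm C)).
  apply: opnorm_le => [|x]; first by rewrite addr_ge0// opnorm_ge0.
  have -> : S x = P x - C x by rewrite /C/= opprB addrC subrK.
  apply: le_trans (nrmD _ _) _; rewrite nrmN mulrDl mul1r.
  by apply: lerD; [exact: nrm_orthoproj|exact: opnorm_ub].
by move: C1; lra.
Qed.

Lemma spectral_radius_lt2 : spectral_radius C < 1 -> opnorm T < 2.
Proof.
rewrite opnorm_abs_operator => r1.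
(* [opnorm_in_spectrum] asks for a nonzero [S]. *)
have [s0|s0] := leP (opnorm S) 0; first exact: le_lt_trans s0 _.
have := le_spectral_radius bC CC (opnorm_in_spectrum subM clM posS SP s0).
rewrite normc_def/= expr0n/= addr0 sqrtr_sqr => /le_lt_trans/(_ r1).
by rewrite ltr_norml => /andP[]; lra.
Qed.

Lemma polar_splitting_equivalences V : T = U \- V ->
  [<-> convergent_proper_splitting T U V; opnorm (U \- T) < 1;
       opnorm (orthoproj (range (adjoint T)) \- S) < 1; opnorm T < 2].
Proof.
move=> TUV; rewrite range_adjoint opnorm_polar_sub -/P -/C.
have BV : moore_penrose U \o V = C.
  by apply/funext => x; exact: moore_penrose_iteration.
(* The second and third assertions have become the same. The first reaches the second through |T| <
   2, and the fourth returns to the first because the spectral radius is at most the norm. *)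
rewrite /convergent_proper_splitting BV; tfae => //.
- by move=> [_ /spectral_radius_lt2/opnorm_lt2_sub].
- exact: opnorm_sub_lt2.
- move=> /opnorm_lt2_sub C1; split; first exact: polar_proper_splitting.
  exact: le_lt_trans (selfadjoint_spectral_radius_le bC CC) C1.
Qed.

End PolarSplitting.

Theorem theorem4p3 (R : realType) (H : hilbertType R) (T V : H -> H)
    (closed_range_T : closed_range T)
    (polar_splitting : T = polar_factor T \- V) :
  [<-> convergent_proper_splitting T (polar_factor T) V;
       opnorm (polar_factor T \- T) < 1;
       opnorm (orthoproj (range (adjoint T)) \- abs_operator T) < 1;
       opnorm T < 2].
Proof. exact: polar_splitting_equivalences. Qed.
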